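(* Let $x,y\in\mathcal{H}$ with $y\neq0$. Then $$|\langle x,y\rangle|\le\min_{t\in[0,1]}\Big\|tx+(1-t)\frac{\langle x,y\rangle}{\|y\|^2}y\Big\|\,\|y\|\le\min_{t\in[0,1]}\Big(\Big\|(1-t)^2x+t^2\frac{\langle x,y\rangle}{\|y\|^2}y\Big\|\,\|y\|+2t(1-t)|\langle x,y\rangle|\Big)\le\|x\|\,\|y\|.$$
   Context: $\mathcal{H}$ is a complex Hilbert space with inner product $\langle\cdot,\cdot\rangle$ (linear in the first argument) and norm $\|x\|=\langle x,x\rangle^{1/2}$. *)

(* Defs.v *)
From mathcomp Require Import all_boot all_order all_algebra.
From mathcomp Require Import all_classical all_reals all_analysis.
From mathcomp Require Export complex.

Set Implicit Arguments.
Unset Strict Implicit.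
Unset Printing Implicit Defensive.

Import Order.TTheory GRing.Theory Num.Theory.
Import numFieldNormedType.Exports.

Local Open Scope classical_set_scope.
Local Open Scope ring_scope.

(* On [R[i]] the order is partial, [a <= b] meaning that [b - a] is a
   nonnegative real; norms and moduli are nonnegative elements of [R[i]]. *)
Definition is_minimum (R : realType) (A : set R[i]) (m : R[i]) : Prop :=
  A m /\ lbound A m.

(* The complete norm of [H] is the one induced by the inner product.  In
   [{dot H for Num.conj}] the form is linear in its first argument and
   conjugate-linear in its second one. *)
Definition hilbert_norm (R : realType) (H : completeNormedModType R[i])
    (dot : {dot H for Num.conj}) : Prop :=
  forall u : H, `|u| = sqrtC (dot u u).

(* Main.v *)
(* Both minima equal |<x,y>|.  With p the projection of x on the line of y we
   have <p,y> = <x,y>, so Cauchy-Schwarz applied to a x + b p and y gives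
   (a + b) |<x,y>| <= |a x + b p| |y| for a, b >= 0.  The lower bounds follow,
   as t + (1 - t) = 1 and (1 - t)^2 + t^2 + 2 t (1 - t) = 1; they are attained
   at t = 0 and t = 1 respectively, where only |p| |y| = |<x,y>| remains. *)
Require Import Defs.
From mathcomp Require Import all_boot all_order all_algebra.
From mathcomp Require Import all_classical all_reals all_analysis.
From mathcomp Require Import complex.
From mathcomp Require Import ring.

Import Order.TTheory GRing.Theory Num.Theory.
Import numFieldNormedType.Exports.

Local Open Scope classical_set_scope.
Local Open Scope ring_scope.
Local Open Scope complex_scope.

(* [CauchySchwarz] of mathcomp.algebra.sesquilinear requires finite dimension. *)
Lemma dot_cauchy_schwarz (C : numClosedFieldType) (U : lmodType C)
    (dot : {dot U for Num.conj}) (u v : U) :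
  `|dot u v| <= sqrtC (dot u u) * sqrtC (dot v v).
Proof.
have [->|v0] := eqVneq v 0; first by rewrite !linear0r normr0 sqrtC0 mulr0.
have dv : dot v v != 0 by rewrite dnorm_eq0.
(* [c *: v] is the orthogonal projection of [u] on the line of [v]. *)
pose c := dot u v / dot v v.
have ortho : dot (u - c *: v) (c *: v) = 0.
  by rewrite linearZr_LR /= linearBl linearZl_LR /= divfK// subrr mulr0.
rewrite -sqrtCM ?nnegrE ?dnorm_ge0// -(sqrCK (normr_ge0 _)).
rewrite ler_sqrtC ?nnegrE ?exprn_ge0 ?mulr_ge0 ?dnorm_ge0//.
have -> : `|dot u v| ^+ 2 = dot (c *: v) (c *: v) * dot v v.
  rewrite dnormZ normf_div expr_div_n (ger0_norm (dnorm_ge0 _ v)).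
  by rewrite -mulrA -expr2 divfK// expf_neq0.
(* After cancelling [dot v v], Pythagoras for [u = (u - c *: v) + c *: v] shows that the projection
   is no longer than [u]. *)
rewrite ler_wpM2r ?dnorm_ge0// -[in leRHS](subrK (c *: v) u) dnormD ortho.
by rewrite rmorph0 !addr0 lerDr dnorm_ge0.
Qed.

Theorem corollary2p18 (R : realType) (H : completeNormedModType R[i])
    (dot : {dot H for Num.conj}) (hdot : hilbert_norm dot)
    (x y : H) (hy : y != 0) :
  exists m1 m2 : R[i],
    [/\ is_minimum
          [set `|t%:C *: x + (1 - t%:C) *: ((dot x y / `|y| ^+ 2) *: y)|
                 * `|y| | t in [set t : R | 0 <= t <= 1]] m1,
        is_minimum
          [set `|(1 - t%:C) ^+ 2 *: x
                 + t%:C ^+ 2 *: ((dot x y / `|y| ^+ 2) *: y)| * `|y|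
               + 2 * t%:C * (1 - t%:C) * `|dot x y|
             | t in [set t : R | 0 <= t <= 1]] m2
      & [/\ `|dot x y| <= m1, m1 <= m2 & m2 <= `|x| * `|y|]].
Proof.
have cs u : `|dot u y| <= `|u| * `|y| by rewrite !hdot dot_cauchy_schwarz.
have y0 : `|y| != 0 by rewrite normr_eq0.
set p := (dot x y / `|y| ^+ 2) *: y.
have np : `|p| * `|y| = `|dot x y|.
  rewrite normrZ normf_div normrX normr_id -mulrA -expr2 divfK//.
  by rewrite expf_neq0.
have dp : dot p y = dot x y.
  rewrite linearZl_LR /= hdot sqrtCK divfK//.
  by apply: contra y0 => /eqP dy; rewrite hdot dy sqrtC0.
(* From here on, [p] is known only through [np] and [dp]. *)
clearbody p; have lb (a b : R[i]) : 0 <= a -> 0 <= b ->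
    (a + b) * `|dot x y| <= `|a *: x + b *: p| * `|y|.
  move=> a0 b0; apply: le_trans (cs _).
  have -> : dot (a *: x + b *: p) y = (a + b) * dot x y.
    by rewrite mulrDl linearDl /= !linearZl_LR /= dp.
  by rewrite normrM (ger0_norm (addr_ge0 a0 b0)).
have C01 (t : R) : 0 <= t <= 1 -> 0 <= t%:C /\ 0 <= 1 - t%:C.
  by rewrite subr_ge0 -lecR -(lecR t) => /andP.
(* With equal minima the chain reduces to reflexivity and [cs x]. *)
exists `|dot x y|, `|dot x y|; split; last by split.
- split; first by exists 0; rewrite /= ?lexx ?ler01// scale0r add0r subr0 scale1r.
  move=> _ [t /C01[t0 t1] <-].
  by have := lb _ _ t0 t1; rewrite addrC subrK mul1r.
- split.
    exists 1; rewrite /= ?lexx ?ler01//.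
    by rewrite subrr expr0n scale0r add0r expr1n scale1r mulr0 mul0r addr0.
  move=> _ [t /C01[t0 t1] <-].
  (* The cross term moves to the left, where [1 - 2t(1-t) = (1-t)^2 + t^2] is the coefficient that
     [lb] provides. *)
  have := lb _ _ (exprn_ge0 2 t1) (exprn_ge0 2 t0).
  by rewrite -lerBlDr; apply: le_trans; rewrite le_eqVlt; apply/orP/or_introl/eqP; ring.
Qed.
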